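(* Let $\mathbb{SU}=\prod_{n=1}^\infty SU(n)$. For a comeager set of $G\in\mathcal{S}(\mathbb{SU})$, the quotient $G/G^\circ$ is homeomorphic to the Cantor set.
   Context: $\mathbb{SU}$ carries the product topology, metrized by $d(x,y)=\sum_n 2^{-n}d_n(x(n),y(n))$ where $d_n\le 1$ is a biinvariant metric on $SU(n)$. $\mathcal{S}(\mathbb{SU})$ is the set of nonempty compact subgroups of $\mathbb{SU}$ with the Hausdorff metric induced by $d$. $G^\circ$ denotes the identity component of $G$ (the connected component of the identity), a closed normal subgroup; $G/G^\circ$ has the quotient topology. *)

(* Defs.v *)
From HB Require Import structures.
From mathcomp Require Import all_boot all_order all_algebra complex.
From mathcomp Require Import all_classical all_reals.
From mathcomp Require Import interval_inference topology normedtype sequences cantor.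

Set Implicit Arguments.
Unset Strict Implicit.
Unset Printing Implicit Defensive.

Import Order.TTheory GRing.Theory Num.Theory.
Import numFieldTopology.Exports numFieldNormedType.Exports.

Local Open Scope classical_set_scope.
Local Open Scope ring_scope.

Section Topology.

Definition homeomorphic (T U : topologicalType) : Prop :=
  exists (f : T -> U) (g : U -> T),
    [/\ cancel f g, cancel g f, continuous f & continuous g].

Variable T : topologicalType.
Implicit Type A : set T.

Definition nowhere_dense A : Prop := (closure A)° = set0.

Definition meager A : Prop :=
  exists2 F : nat -> set T,
    forall n, nowhere_dense (F n) & A `<=` \bigcup_n F n.

Definition comeager A : Prop := meager (~` A).

End Topology.

Section HausdorffDistance.
Variables (R : realType) (T : Type) (d : T -> T -> R).

Definition dist_to_set (x : T) (A : set T) : R := inf [set d x y | y in A].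

Definition hausdorff_dist (A B : set T) : R :=
  Num.max (sup [set dist_to_set x B | x in A])
          (sup [set dist_to_set y A | y in B]).

Hypothesis dxx : forall x, d x x = 0.
Hypothesis d_sym : forall x y, d x y = d y x.
Hypothesis d_tri : forall y x z, d x z <= d x y + d y z.
Hypothesis d_ge0 : forall x y, 0 <= d x y.
Hypothesis d_le1 : forall x y, d x y <= 1.

Let d_lb x A : has_lbound [set d x y | y in A].
Proof. by exists 0 => _ [y _ <-]. Qed.

Let dist_to_set_le x y A : A y -> dist_to_set x A <= d x y.
Proof. by move=> Ay; apply: ge_inf => //; exists y. Qed.

Let dist_to_set_ge0 x A : A !=set0 -> 0 <= dist_to_set x A.
Proof.
by case=> y Ay; apply: lb_le_inf; [exists (d x y), y|move=> _ [z _ <-]].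
Qed.

Let ex_lt_dist_to_set x A e : A !=set0 -> dist_to_set x A < e ->
  exists2 y, A y & d x y < e.
Proof.
case=> y Ay lte.
have [||_ [z Az <-] ltz] := @inf_adherent _ [set d x y | y in A]
    (e - dist_to_set x A).
- by rewrite subr_gt0.
- by split=> //; exists (d x y), y.
by exists z => //; rewrite (lt_le_trans ltz)// /dist_to_set addrC subrK.
Qed.

Let dist_to_set_ub A B : B !=set0 ->
  has_ubound [set dist_to_set x B | x in A].
Proof.
by case=> y By; exists 1 => _ [x _ <-]; exact: le_trans (dist_to_set_le x By) _.
Qed.

Lemma hausdorff_dist_ge A B x : B !=set0 -> A x ->
  dist_to_set x B <= hausdorff_dist A B.
Proof.
move=> B0 Ax; rewrite /hausdorff_dist le_max; apply/orP; left.
by apply: ub_le_sup; [exact: dist_to_set_ub|exists x].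
Qed.

Lemma hausdorff_distC A B : hausdorff_dist A B = hausdorff_dist B A.
Proof. by rewrite /hausdorff_dist maxC. Qed.

Let hausdorff_dist_le A B e : A !=set0 -> B !=set0 ->
  (forall x, A x -> dist_to_set x B <= e) ->
  (forall y, B y -> dist_to_set y A <= e) -> hausdorff_dist A B <= e.
Proof.
move=> [a Aa] [b Bb] AB BA; rewrite /hausdorff_dist ge_max; apply/andP; split.
  by apply: ge_sup; [exists (dist_to_set a B), a|move=> _ [x Ax <-]; exact: AB].
by apply: ge_sup; [exists (dist_to_set b A), b|move=> _ [x Ax <-]; exact: BA].
Qed.

Lemma hausdorff_dist_ge0 A B : A !=set0 -> B !=set0 -> 0 <= hausdorff_dist A B.
Proof.
move=> [a Aa] B0; apply: le_trans (hausdorff_dist_ge B0 Aa).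
exact: dist_to_set_ge0.
Qed.

Lemma hausdorff_distxx A : A !=set0 -> hausdorff_dist A A = 0.
Proof.
move=> A0; apply/eqP; rewrite eq_le hausdorff_dist_ge0// andbT.
by apply: hausdorff_dist_le => // x Ax;
  rewrite -(dxx x); exact: dist_to_set_le.
Qed.

Lemma hausdorff_dist_eq0 A B x e : B !=set0 -> hausdorff_dist A B = 0 -> A x ->
  0 < e -> exists2 y, B y & d x y < e.
Proof.
move=> B0 AB0 Ax e0; apply: ex_lt_dist_to_set => //.
by apply: le_lt_trans e0; rewrite -AB0; exact: hausdorff_dist_ge.
Qed.

Let dist_to_set_triangle A B C x : A !=set0 -> B !=set0 -> C !=set0 ->
  A x -> dist_to_set x C <= hausdorff_dist A B + hausdorff_dist B C.
Proof.
move=> A0 B0 C0 Ax; apply/ler_addgt0Pl => e e0.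
have e20 : 0 < e / 2 by rewrite divr_gt0.
have [|y By xy] := @ex_lt_dist_to_set x B (hausdorff_dist A B + e / 2) B0.
  by rewrite (le_lt_trans (hausdorff_dist_ge B0 Ax))// ltrDl.
have [|z Cz yz] := @ex_lt_dist_to_set y C (hausdorff_dist B C + e / 2) C0.
  by rewrite (le_lt_trans (hausdorff_dist_ge C0 By))// ltrDl.
rewrite (le_trans (dist_to_set_le x Cz))// (le_trans (d_tri y x z))//.
by rewrite (le_trans (ltW (ltrD xy yz)))// addrACA -splitr addrC.
Qed.

Lemma hausdorff_dist_triangle B A C : A !=set0 -> B !=set0 -> C !=set0 ->
  hausdorff_dist A C <= hausdorff_dist A B + hausdorff_dist B C.
Proof.
move=> A0 B0 C0; apply: hausdorff_dist_le => // x Hx.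
  exact: dist_to_set_triangle.
rewrite addrC (hausdorff_distC A) (hausdorff_distC B).
exact: dist_to_set_triangle.
Qed.

End HausdorffDistance.

HB.instance Definition _ (R : realType) :=
  PseudoPointedMetric.copy R[i] (R[i])^o.

Section SpecialUnitary.
Local Open Scope sesquilinear_scope.
Variables (R : realType) (n : nat).

Definition special_unitary : {pred 'M[R[i]]_n} :=
  [pred M | (M \is unitarymx) && (\det M == 1)].

Record SU := MkSU { SUval :> 'M[R[i]]_n; _ : SUval \in special_unitary }.

HB.instance Definition _ := [isSub for SUval].
HB.instance Definition _ := [Choice of SU by <:].
HB.instance Definition _ := Topological.copy SU (initial_topology SUval).

Fact special_unitary1 : 1%:M \in special_unitary.
Proof.
by rewrite inE det1 eqxx andbT; apply/unitarymxP; rewrite trmx1 map_mx1 mulmx1.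
Qed.

Fact special_unitaryM (x y : SU) : SUval x *m SUval y \in special_unitary.
Proof.
case: x y => [x /= /andP[xU /eqP x1]] [y /= /andP[yU /eqP y1]].
by rewrite inE mul_unitarymx//= det_mulmx x1 y1 mulr1.
Qed.

Fact special_unitaryV (x : SU) : (SUval x)^t* \in special_unitary.
Proof.
case: x => [x /= /andP[xU /eqP x1]].
by rewrite inE trmxC_unitary xU/= det_map_mx det_tr x1 rmorph1.
Qed.

Definition SU1 := MkSU special_unitary1.
Definition SUmul (x y : SU) := MkSU (special_unitaryM x y).
Definition SUinv (x : SU) := MkSU (special_unitaryV x).

Fact SUmulA : associative SUmul.
Proof. by move=> x y z; apply: val_inj; rewrite /= mulmxA. Qed.
Fact SUmul1 : left_id SU1 SUmul.
Proof. by move=> x; apply: val_inj; rewrite /= mul1mx. Qed.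
Fact SU1mul : right_id SU1 SUmul.
Proof. by move=> x; apply: val_inj; rewrite /= mulmx1. Qed.
Fact SUmulV : right_inverse SU1 SUinv SUmul.
Proof.
by move=> [x /= xU]; apply: val_inj => /=; apply/unitarymxP; case/andP: xU.
Qed.
Fact SUVmul : left_inverse SU1 SUinv SUmul.
Proof.
by move=> x; apply: val_inj => /=; apply/mulmx1C/(congr1 SUval (SUmulV x)).
Qed.

HB.instance Definition _ := isGroup.Build SU SUmulA SUmul1 SU1mul SUVmul SUmulV.

Record biinvariant_metric := BiinvariantMetric {
  bidist :> SU -> SU -> R;
  bidistxx : forall x, bidist x x = 0;
  bidist_eq0 : forall x y, bidist x y = 0 -> x = y;
  bidist_sym : forall x y, bidist x y = bidist y x;
  bidist_triangle : forall y x z, bidist x z <= bidist x y + bidist y z;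
  bidist_le1 : forall x y, bidist x y <= 1;
  bidistMl : forall g x y, bidist (g * x)%g (g * y)%g = bidist x y;
  bidistMr : forall g x y, bidist (x * g)%g (y * g)%g = bidist x y;
  (* the metric induces the usual topology of SU *)
  bidist_nbhs : forall (x : SU) (A : set SU),
    nbhs x A <-> exists2 e, 0 < e & [set y | bidist x y < e] `<=` A }.

End SpecialUnitary.

(* The n-th factor is SU(n+1), so that the factors are SU(1), SU(2), etc *)
Definition SUprod (R : realType) : Type := prod_topology (fun n => SU R n.+1).

Section ProductGroup.
Variable R : realType.
Local Notation SUprod := (SUprod R).

HB.instance Definition _ := Topological.on SUprod.

Definition SUprod1 : SUprod := fun n => 1%g.
Definition SUprod_mul (x y : SUprod) : SUprod := fun n => (x n * y n)%g.
Definition SUprod_inv (x : SUprod) : SUprod := fun n => (x n)^-1%g.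

Fact SUprod_mulA : associative SUprod_mul.
Proof.
by move=> x y z; apply: functional_extensionality_dep => n; exact: mulgA.
Qed.
Fact SUprod_mul1 : left_id SUprod1 SUprod_mul.
Proof. by move=> x; apply: functional_extensionality_dep => n; exact: mul1g. Qed.
Fact SUprod_1mul : right_id SUprod1 SUprod_mul.
Proof. by move=> x; apply: functional_extensionality_dep => n; exact: mulg1. Qed.
Fact SUprod_Vmul : left_inverse SUprod1 SUprod_inv SUprod_mul.
Proof. by move=> x; apply: functional_extensionality_dep => n; exact: mulVg. Qed.
Fact SUprod_mulV : right_inverse SUprod1 SUprod_inv SUprod_mul.
Proof. by move=> x; apply: functional_extensionality_dep => n; exact: mulgV. Qed.

HB.instance Definition _ := isGroup.Build SUprod
  SUprod_mulA SUprod_mul1 SUprod_1mul SUprod_Vmul SUprod_mulV.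

End ProductGroup.

Section ProductMetric.
Variable R : realType.
Variable d : forall n, biinvariant_metric R n.+1.
Implicit Types x y z : SUprod R.

Let term x y : R^nat := fun n => 2 ^- n.+1 * d n (x n) (y n).

Definition SUdist x y : R := limn (series (term x y)).

Let d_ge0 n (x y : SU R n.+1) : 0 <= d n x y.
Proof.
rewrite -(@pmulrn_lge0 _ _ 2)// mulr2n -[X in _ + X](bidist_sym (d n)).
by rewrite -(bidistxx (d n) x); exact: bidist_triangle.
Qed.

Let term_ge0 x y n : 0 <= term x y n.
Proof. by rewrite mulr_ge0// invr_ge0 exprn_ge0. Qed.

Let term_le x y n : term x y n <= geometric 2^-1 2^-1 n.
Proof.
by rewrite /geometric/= -exprS exprVn ler_piMr ?bidist_le1// invr_ge0 exprn_ge0.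
Qed.

Let half_lt1 : `|2^-1 : R| < 1.
Proof. by rewrite ger0_norm ?invr_ge0// invf_lt1// ltr1n. Qed.

Let cvg_term x y : cvgn (series (term x y)).
Proof.
apply: series_le_cvg (term_ge0 x y) _ (term_le x y) _.
  by move=> n; exact: le_trans (term_ge0 x y n) (term_le x y n).
exact: is_cvg_geometric_series.
Qed.

Let term_le_SUdist x y n : term x y n <= SUdist x y.
Proof.
have /nondecreasing_cvgn_le/(_ (@cvg_term x y) n.+1) :
    nondecreasing_seq (series (term x y)).
  by apply/nondecreasing_series => i _ _; exact: term_ge0.
apply: le_trans; rewrite seriesSr lerDr.
by apply: sumr_ge0 => i _; exact: term_ge0.
Qed.

Lemma SUdist_ge0 x y : 0 <= SUdist x y.
Proof. exact: le_trans (term_ge0 x y 0) (term_le_SUdist x y 0). Qed.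

Lemma SUdistxx x : SUdist x x = 0.
Proof.
have s0 : series (term x x) = cst 0.
  by apply: funext => n; rewrite /series/= big1// => i _;
    rewrite /term bidistxx mulr0.
by rewrite /SUdist s0; apply: lim_cst; exact: Rhausdorff.
Qed.

Lemma SUdist_sym x y : SUdist x y = SUdist y x.
Proof.
rewrite /SUdist; suff -> : term x y = term y x by [].
by apply: funext => n; rewrite /term bidist_sym.
Qed.

Lemma SUdist_triangle y x z : SUdist x z <= SUdist x y + SUdist y z.
Proof.
rewrite /SUdist -limD; [|exact: cvg_term..].
rewrite -seriesD; apply: lim_series_le; first exact: cvg_term.
  by rewrite seriesD; apply: is_cvgD; exact: cvg_term.
move=> n; rewrite /term/= -mulrDr ler_wpM2l ?invr_ge0 ?exprn_ge0//.
exact: bidist_triangle.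
Qed.

Lemma SUdist_le1 x y : SUdist x y <= 1.
Proof.
have -> : 1 = limn (series (geometric (2^-1 : R) 2^-1)).
  rewrite (cvg_lim _ (cvg_geometric_series half_lt1))//.
  have -> : 1 - 2^-1 = 2^-1 :> R by rewrite [X in X - _]splitr mul1r addrK.
  by rewrite divff ?invr_eq0 ?pnatr_eq0.
rewrite /SUdist; apply: lim_series_le; first exact: cvg_term.
  exact: is_cvg_geometric_series.
exact: term_le.
Qed.

Let SU_hausdorff n : hausdorff_space (SU R n.+1).
Proof.
move=> p q pq; apply: (bidist_eq0 (b := d n)); apply/eqP.
rewrite eq_le d_ge0 andbT; apply/ler_addgt0Pl => e e0; rewrite addr0.
have e20 : 0 < e / 2 by rewrite divr_gt0.
have nb r : nbhs r [set s | d n r s < e / 2].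
  by apply/(bidist_nbhs (d n)); exists (e / 2).
have [s [/= ps qs]] := pq _ _ (nb p) (nb q).
rewrite (le_trans (bidist_triangle (d n) s p q))//.
by rewrite (splitr e) lerD// ltW// bidist_sym.
Qed.

Lemma SUprod_hausdorff : hausdorff_space (SUprod R).
Proof. exact: hausdorff_product. Qed.

Let SUdist_cvg (u : nat -> SUprod R) x :
  (forall k, SUdist x (u k) < k.+1%:R^-1) -> u @ \oo --> x.
Proof.
move=> ux; apply/cvg_sup => i U [_ [[V oV <-] Vx] VU].
have /(bidist_nbhs (d i)) [e e0 eV] : nbhs (x i) V by exact: open_nbhs_nbhs.
have e'0 : 0 < 2 ^- i.+1 * e by rewrite mulr_gt0// invr_gt0 exprn_gt0.
suff : \forall k \near \oo, U (u k) by [].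
near=> k; apply: VU; apply: eV => /=.
rewrite -(@ltr_pM2l _ (2 ^- i.+1)) ?invr_gt0 ?exprn_gt0//.
have := term_le_SUdist x (u k) i => /le_lt_trans; apply.
apply: lt_trans (ux k) _; near: k.
exact: (near_infty_natSinv_lt (PosNum e'0)).
Unshelve. all: by end_near. Qed.

Lemma compact_SUdist (A : set (SUprod R)) x : compact A ->
  (forall e, 0 < e -> exists2 y, A y & SUdist x y < e) -> A x.
Proof.
move=> cA Ax.
have /choice[u uP] k : exists y, A y /\ SUdist x y < k.+1%:R^-1.
  by have [//|y Ay xy] := Ax k.+1%:R^-1; exists y.
apply: (closed_cvg A _ _ x (SUdist_cvg (fun k => (uP k).2))).
  exact: compact_closed SUprod_hausdorff cA.
by apply: nearW => k; case: (uP k).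
Qed.

End ProductMetric.

Section CompactSubgroups.
Variable R : realType.

(* The parameter d only serves to determine the metric put on this type;
   nonemptiness of the carrier follows from csg_group *)
Record compact_subgroup (d : forall n, biinvariant_metric R n.+1) :=
  CompactSubgroup {
    csg_set :> set (SUprod R);
    csg_compact : compact csg_set;
    csg_group : group_closed (mem csg_set) }.

Variable d : forall n, biinvariant_metric R n.+1.
Local Notation S := (compact_subgroup d).
Implicit Types G H K : S.

HB.instance Definition _ := gen_eqMixin S.
HB.instance Definition _ := gen_choiceMixin S.

Lemma csg_inj G H : csg_set G = csg_set H -> G = H.
Proof.
case: G H => [G cG gG] [H cH gH] /= GH; rewrite -{}GH in cH gH *.
by congr CompactSubgroup; exact: Prop_irrelevance.
Qed.

Lemma csg_neq0 G : csg_set G !=set0.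
Proof. by exists 1%g; apply: set_mem; case: (csg_group G). Qed.

Definition csg_dist G H : R := hausdorff_dist (SUdist d) G H.

Fact csg_distxx G : csg_dist G G = 0.
Proof.
by apply: hausdorff_distxx (csg_neq0 G);
  [exact: SUdistxx|exact: SUdist_ge0|exact: SUdist_le1].
Qed.

Fact csg_dist_sym G H : csg_dist G H = csg_dist H G.
Proof. exact: hausdorff_distC. Qed.

Fact csg_dist_eq0 G H : csg_dist G H = 0 -> G = H.
Proof.
have sub G' H' : csg_dist G' H' = 0 -> csg_set G' `<=` csg_set H'.
  move=> GH x Gx; apply: (compact_SUdist (d := d)); first exact: csg_compact.
  move=> e e0; apply: hausdorff_dist_eq0 GH Gx e0 => //.
  - exact: SUdist_ge0.
  - exact: SUdist_le1.
  - exact: csg_neq0.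
move=> GH; apply: csg_inj; apply/seteqP; split; apply: sub => //.
by rewrite csg_dist_sym.
Qed.

Fact csg_dist_triangle K G H :
  csg_dist G H <= csg_dist G K + csg_dist K H.
Proof.
apply: hausdorff_dist_triangle (csg_neq0 G) (csg_neq0 K) (csg_neq0 H).
- exact: SUdist_triangle.
- exact: SUdist_ge0.
- exact: SUdist_le1.
Qed.

HB.instance Definition _ := isMetric.Build R S
  csg_distxx csg_dist_eq0 csg_dist_sym csg_dist_triangle.

End CompactSubgroups.

Section ComponentGroup.
Variables (R : realType) (G : set (SUprod R)).

Definition identity_component : set (SUprod R) := connected_component G 1%g.

Definition coset_rel : rel (set_type G) := fun x y =>
  `[< [set (\val x * g)%g | g in identity_component] =
      [set (\val y * g)%g | g in identity_component] >].

Fact coset_rel_equiv : equiv_class_of coset_rel.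
Proof.
split=> [x|x y|y x z]; first exact/asboolP.
  by apply/asboolP/asboolP.
by move=> /asboolP xy /asboolP yz; apply/asboolP; rewrite xy.
Qed.

Canonical coset_equiv := EquivRelPack coset_rel_equiv.

(* G / G°, the left cosets of G° in G *)
Definition component_group : topologicalType :=
  quotient_topology {eq_quot coset_equiv}%qT.

End ComponentGroup.

(* Main.v *)
(* For compact G the component of the identity consists of the points that can
be joined to 1 by e-chains in G for every e > 0.  As d is left invariant,
"joined by an e-chain" is compatible with left translations, so these
relations descend to G / G° and are the balls of an ultrametric inducing the
quotient topology. Hence G / G° is compact and zero-dimensional, and it is a
Cantor set as soon as it has no isolated point, that is, as soon as G°
contains no ball of G about 1.

   It remains to see that, for fixed e > 0, the groups G whose e-ball about 1
lies in G° form a nowhere dense set. Given G, keep the coordinates below a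
large index i, let the i-th coordinate range over {1, u} with u an involution,
and make the later coordinates trivial. The resulting group H is 2^-i-close to
G, and for every K close enough to H the i-th coordinates of K cluster near 1
or near u; this separates 1 from points of K near it. *)
From HB Require Import structures.
Require Import Defs.
From mathcomp Require Import all_boot all_order all_algebra complex.
From mathcomp Require Import all_classical all_reals.
From mathcomp Require Import interval_inference topology normedtype sequences.
From mathcomp Require Import cantor lra.

Set Implicit Arguments.
Unset Strict Implicit.
Unset Printing Implicit Defensive.

Import Order.TTheory GRing.Theory Num.Theory.
Import numFieldTopology.Exports numFieldNormedType.Exports.

Local Open Scope classical_set_scope.
Local Open Scope ring_scope.

(** * The product metric *)

Section ProductMetric.
Variables (R : realType) (d : forall n, biinvariant_metric R n.+1).
Implicit Types x y z g : SUprod R.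

Let term x y : R^nat := fun n => 2 ^- n.+1 * d n (x n) (y n).

Lemma bidist_ge0 n (b : biinvariant_metric R n) (x y : SU R n) : 0 <= b x y.
Proof.
rewrite -(@pmulrn_lge0 _ _ 2)// mulr2n -[X in _ + X](bidist_sym b).
by rewrite -(bidistxx b x); exact: bidist_triangle.
Qed.

Let term_ge0 x y n : 0 <= term x y n.
Proof. by rewrite mulr_ge0 ?bidist_ge0// invr_ge0 exprn_ge0. Qed.

Let halfS n : 2 ^- n = 2 ^- n.+1 + 2 ^- n.+1 :> R.
Proof. by rewrite exprS invfM {1}[2 ^- n]splitr mulrC. Qed.

(** The first [n] weights add up to [1 - 2^-n]. From index [N] on only [d j <= 1] is known, which
    costs the extra [2^-N - 2^-n]; this closed form is stable under induction on [n]. *)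
Let sum_term_le x y e N n : 0 <= e ->
  (forall j, (j < N)%N -> d j (x j) (y j) <= e) ->
  series (term x y) n <=
    e * (1 - 2 ^- n) + (if (n <= N)%N then 0 else 2 ^- N - 2 ^- n).
Proof.
move=> e0 de; elim: n => [|n ih].
  by rewrite /series/= big_geq// expr0 invr1 subrr mulr0 addr0.
have p0 : 0 <= 2 ^- n.+1 :> R by rewrite invr_ge0 exprn_ge0.
rewrite seriesSr (le_trans (lerD ih (lexx _)))// /term (halfS n).
have [nN|Nn] := ltnP n N.
  rewrite (ltnW nN) !addr0.
  have := ler_wpM2l p0 (de _ nN); set t := _ * d _ _ _; set p := 2 ^- n.+1.
  by rewrite mulrBr mulrBr mulr1 mulrDr (mulrC e p); lra.
have := ler_wpM2l p0 (bidist_le1 (d n) (x n) (y n)).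
set t := _ * d _ _ _; have := mulr_ge0 e0 p0.
have [nN|_] := leqP n N.
  have <- : n = N by apply/eqP; rewrite eqn_leq nN Nn.
  by rewrite (halfS n); lra.
by lra.
Qed.

Let cvg_term x y : cvgn (series (term x y)).
Proof.
apply: nondecreasing_is_cvgn.
  by apply/nondecreasing_series => i _ _; exact: term_ge0.
exists 1 => _ [n _ <-].
(* With [e = 1] and [N = n] no tail remains, so every partial sum is at most 1. *)
have := @sum_term_le x y 1 n n ler01 (fun j _ => bidist_le1 _ _ _).
rewrite leqnn mul1r addr0 => /le_trans; apply.
by rewrite gerBl invr_ge0 exprn_ge0.
Qed.

Lemma bidist_le_SUdist x y n : 2 ^- n.+1 * d n (x n) (y n) <= SUdist d x y.
Proof.
have /nondecreasing_cvgn_le/(_ (@cvg_term x y) n.+1) :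
    nondecreasing_seq (series (term x y)).
  by apply/nondecreasing_series => i _ _; exact: term_ge0.
apply: le_trans; rewrite seriesSr lerDr.
by apply: sumr_ge0 => i _; exact: term_ge0.
Qed.

Lemma bidist_lt_SUdist x y n e :
  SUdist d x y < 2 ^- n.+1 * e -> d n (x n) (y n) < e.
Proof.
move=> xy; rewrite -(@ltr_pM2l _ (2 ^- n.+1)) ?invr_gt0 ?exprn_gt0//.
exact: le_lt_trans (bidist_le_SUdist x y n) xy.
Qed.

Lemma SUdist_le x y e N : 0 <= e ->
  (forall j, (j < N)%N -> d j (x j) (y j) <= e) ->
  SUdist d x y <= e + 2 ^- N.
Proof.
move=> e0 de; apply: limr_le; first exact: cvg_term.
apply: nearW => n; apply: le_trans (sum_term_le n e0 de) _.
have p0 m : 0 <= 2 ^- m :> R by rewrite invr_ge0 exprn_ge0.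
rewrite lerD//.
  by rewrite ler_piMr// gerBl.
by case: ifP => // _; rewrite gerBl.
Qed.

Lemma SUdistMl g x y : SUdist d (g * x)%g (g * y)%g = SUdist d x y.
Proof.
rewrite /SUdist; congr (limn (series _)); apply: funext => n.
by rewrite bidistMl.
Qed.

Lemma nbhs_bidist n (p : SU R n.+1) e :
  0 < e -> \forall q \near p, d n p q < e.
Proof. by move=> e0; apply/(bidist_nbhs (d n)); exists e. Qed.

Lemma cvg_proj n x : (y n) @[y --> x] --> x n.
Proof. exact: (@proj_continuous nat (fun n => SU R n.+1) n x). Qed.

Lemma near_exp2V e : 0 < e -> \forall N \near \oo, 2 ^- N < e :> R.
Proof.
move=> e0; have h1 : `|2^-1| < 1 :> R.
  by rewrite ger0_norm ?invr_ge0// invf_lt1// ltr1n.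
have /cvgrPdist_lt/(_ _ e0) := cvg_expr h1; apply: filterS => N.
by rewrite sub0r normrN ger0_norm ?exprVn// invr_ge0 exprn_ge0.
Qed.

(** A ball is a neighbourhood because the coordinates from a large [N] on contribute at most [2^-N],
    leaving finitely many conditions. Conversely, a subbasic open set restricts one coordinate [i],
    and the weight [2^-(i+1)] turns its radius into one for [SUdist]. *)
Lemma SUdist_nbhs x (A : set (SUprod R)) :
  nbhs x A <-> exists2 e, 0 < e & [set y | SUdist d x y < e] `<=` A.
Proof.
split; last first.
  move=> [e e0 eA]; apply: filterS eA _.
  have e20 : 0 < e / 2 by rewrite divr_gt0.
  have [N _ /(_ N (leqnn _)) Ne] := near_exp2V e20.
  have : nbhs x [set y : SUprod R | forall j : 'I_N, d j (x j) (y j) < e / 2].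
    pose f (j : 'I_N) (y : SUprod R) := d j (x j) (y j) < e / 2.
    apply: (@filter_forall _ _ f (nbhs x) _) => j.
    exact: (cvg_proj (nbhs_bidist (x j) e20)).
  apply: filterS => y xy /=; rewrite (splitr e).
  apply: le_lt_trans (SUdist_le (ltW e20) _) _; last by rewrite ltrD2l; exact: Ne.
  by move=> j jN; exact: ltW (xy (Ordinal jN)).
(* [F] is the filter of metric neighbourhoods of [x]. The product topology is a supremum, so
   convergence of [F] can be tested on each coordinate. *)
pose F : set_system (SUprod R) :=
  filter_from [set e | 0 < e] (fun e => [set y | SUdist d x y < e]).
suff Fx : F --> x by move=> /Fx.
have FF : Filter F.
  apply: filter_from_filter; first by exists 1 => /=.
  move=> i j i0 j0; exists (Num.min i j); first by rewrite /= lt_min i0.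
  by move=> y /=; rewrite lt_min => /andP[].
apply/cvg_sup => i U [_ [[V oV <-] Vx] VU].
have /(bidist_nbhs (d i)) [e e0 eV] : nbhs (x i) V by exact: open_nbhs_nbhs.
exists (2 ^- i.+1 * e); first by rewrite /= mulr_gt0// invr_gt0 exprn_gt0.
by move=> y /bidist_lt_SUdist xy; exact/VU/eV.
Qed.

End ProductMetric.

(** * Chains *)

Section Chains.
Variables (R : realType) (T : Type) (dist : T -> T -> R).
Hypothesis dist_sym : forall x y, dist x y = dist y x.
Implicit Types (A : set T) (x y z : T) (e : R).

(** Only the points reached after [x] are asked to lie in [A], so membership of [x] appears
    separately in the lemmas below. *)
Inductive chain A e x : T -> Prop :=
| chain_refl : chain A e x x
| chain_step y z : chain A e x y -> A z -> dist y z < e -> chain A e x z.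

Lemma chain_in A e x y : A x -> chain A e x y -> A y.
Proof. by move=> Ax; elim. Qed.

Lemma chain_trans A e y x z : chain A e x y -> chain A e y z -> chain A e x z.
Proof. by move=> xy; elim => // u v _ xu Av uv; exact: chain_step uv. Qed.

Lemma chain_sym A e x y : A x -> chain A e x y -> chain A e y x.
Proof.
move=> Ax; elim=> [|u v xu ux Av uv]; first exact: chain_refl.
apply: chain_trans ux; apply: chain_step (chain_refl _ _ _) _ _.
  exact: chain_in xu.
by rewrite dist_sym.
Qed.

Lemma chain_le A e e' x y : e <= e' -> chain A e x y -> chain A e' x y.
Proof.
move=> ee'; elim=> [|u v _ xu Av uv]; first exact: chain_refl.
exact: chain_step xu Av (lt_le_trans uv ee').
Qed.

(** Some single step crosses from [N] to its complement; cutting the chain after that step keeps [v]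
    joined to [x]. *)
Lemma chain_exit A (N : set T) e x y : chain A e x y -> N x -> ~ N y ->
  exists u v, [/\ chain A e x v, N u, ~ N v & dist u v < e].
Proof.
move=> + Nx; elim=> [//|u v xu ih Av uv NNv].
have [Nu|/ih//] := pselect (N u).
by exists u, v; split=> //; exact: chain_step uv.
Qed.

Lemma chain_map A e (f : T -> T) x y :
  (forall u v, dist (f u) (f v) = dist u v) -> (forall u, A u -> A (f u)) ->
  chain A e x y -> chain A e (f x) (f y).
Proof.
move=> df Af; elim=> [|u v _ xu Av uv]; first exact: chain_refl.
by apply: chain_step xu (Af _ Av) _; rewrite df.
Qed.

End Chains.

(** * Chain components and connected components of compact sets *)

Section ChainComponents.
Variables (R : realType) (T : topologicalType) (dist : T -> T -> R).
Hypothesis distxx : forall x, dist x x = 0.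
Hypothesis dist_sym : forall x y, dist x y = dist y x.
Hypothesis dist_tri : forall y x z, dist x z <= dist x y + dist y z.
Hypothesis dist_nbhs : forall x (A : set T),
  nbhs x A <-> exists2 e, 0 < e & [set y | dist x y < e] `<=` A.
Implicit Types (A : set T) (x y z : T) (e : R).
Local Notation chain := (chain dist).

Definition chain_component A x := [set y | forall e, 0 < e -> chain A e x y].

Lemma open_thickening A e : open [set z | exists2 u, A u & dist u z < e].
Proof.
rewrite openE => z [u Au uz]; apply/dist_nbhs; exists (e - dist u z).
  by rewrite subr_gt0.
by move=> y /= zy; exists u => //; have := dist_tri z u y; lra.
Qed.

(** The intersections of [A] with the sets [P e] generate a proper filter, and [p] is one of its
    cluster points. This is how limits are taken as [e] tends to 0. *)
Lemma compact_limit A (P : R -> set T) : compact A ->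
  (forall e e', e <= e' -> P e `<=` P e') ->
  (forall e, 0 < e -> exists2 y, A y & P e y) ->
  exists2 p, A p & forall e, 0 < e -> exists2 y, P e y & dist p y < e.
Proof.
move=> cA Ple Pne.
pose F : set_system T := filter_from [set e | 0 < e] (fun e => A `&` P e).
have FF : ProperFilter F.
  apply: filter_from_proper => [|e /Pne [y Ay Py]]; last by exists y.
  apply: filter_from_filter; first by exists 1 => /=.
  move=> i j i0 j0; exists (Num.min i j); first by rewrite /= lt_min i0.
  by move=> y [Ay Py]; do 2!split=> //; apply: Ple Py; rewrite ge_min lexx ?orbT.
have [|p [Ap clp]] := cA F FF; first by exists 1 => [/=|y []].
exists p => // e e0.
have [||y [[_ Py] /= py]] := clp (A `&` P e) [set y | dist p y < e].
- by exists e.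
- by apply/dist_nbhs; exists e.
by exists y.
Qed.

Lemma chain_component_limit A x p : A p ->
  (forall e, 0 < e -> exists2 y, chain A e x y & dist p y < e) ->
  chain_component A x p.
Proof.
move=> Ap xp e e0; have [y xy py] := xp e e0.
by apply: chain_step xy Ap _; rewrite dist_sym.
Qed.

(** A proper nonempty clopen part [B] would have a thickening [N] that ever finer chains must leave.
    Their exit points accumulate at a point of the chain component outside [N] but so close to [B]
    that it belongs to [B]. *)
Lemma connected_chain_component A x : compact A -> A x ->
  connected (chain_component A x).
Proof.
move=> cA Ax B [b Bb] [O oO BO] [C cC BC].
set Q := chain_component A x.
have BQ z : B z -> Q z by rewrite BO => -[].
have QA z : Q z -> A z by move=> /(_ 1 ltr01); exact: chain_in.
(* Otherwise points of [B] ever closer to the complement of [O] accumulate at some [p], which lies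
   in [B] since [B] is closed, hence in the interior of [O]. The factor 3 pays for the three
   distances from [c] to [u], [v] and [p] at the end. *)
have [r r0 rO] : exists2 r, 0 < r & forall b y, B b -> dist b y < 3 * r -> O y.
  apply: contrapT => /forall2NP rO.
  pose P e b := B b /\ exists2 y, dist b y < e & ~ O y.
  have [||p Ap Pp] := @compact_limit A P cA.
  - by move=> e e' ee' z [Bz [y zy Oy]]; split=> //; exists y => //; lra.
  - move=> e e0; have [//|] := rO (e / 3); first by rewrite divr_gt0.
    move=> /existsNP[c /existsNP[y /not_implyP[Bc /not_implyP[cy Oy]]]].
    exists c; first exact/QA/BQ.
    by split=> //; exists y => //; move: cy; rewrite mulrC divfK// pnatr_eq0.
  have Bp : B p.
    rewrite BC; split.
      apply: chain_component_limit => // e e0.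
      by have [y [By _] py] := Pp e e0; exists y => //; exact: BQ.
    rewrite (closure_id C).1//= => U /dist_nbhs[e e0 eU].
    have [y [By _] py] := Pp e e0; exists y; split; last exact: eU.
    by move: By; rewrite BC => -[].
  have : nbhs p O by apply: open_nbhs_nbhs; split=> //; move: Bp; rewrite BO => -[].
  move=> /dist_nbhs[e e0 eO]; have [|c [_ [y cy Oy]] pc] := Pp (e / 2).
    by rewrite divr_gt0.
  by apply: Oy; apply: eO => /=; have := dist_tri c p y; lra.
apply/seteqP; split=> // y Qy; apply: contrapT => NBy.
pose N := [set z | exists2 c, B c & dist c z < r].
have Nb : N b by exists b => //; rewrite distxx.
have NO z : N z -> O z by move=> [c Bc cz]; apply: rO Bc _; lra.
have NNy : ~ N y by move=> /NO Oy; apply: NBy; rewrite BO.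
(* The exit points: just outside [N] and still joined to [x] by an [e]-chain. *)
pose P e v := [/\ chain A e x v, ~ N v & exists2 u, N u & dist u v < e].
have [||p Ap Pp] := @compact_limit A P cA.
- move=> e e' ee' z [xz Nz [u Nu uz]]; split=> //; first exact: chain_le xz.
  by exists u => //; lra.
- move=> e e0; have xb := BQ _ Bb e e0.
  have bx : chain A e b x by exact: chain_sym xb.
  have [u [v [bv Nu Nv uv]]] := chain_exit (chain_trans bx (Qy e e0)) Nb NNy.
  have xv := chain_trans xb bv.
  exists v; first exact: chain_in xv.
  by split=> //; exists u.
have Qp : Q p.
  apply: chain_component_limit => // e e0.
  by have [v [xv _ _] pv] := Pp e e0; exists v.
have NNp : ~ N p.
  move=> [c Bc cp]; have [|v [_ Nv _] pv] := Pp (r - dist c p).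
    by rewrite subr_gt0.
  by apply: Nv; exists c => //; have := dist_tri p c v; lra.
(* The limit [p] is within [3 * r] of [c] in [B], hence in [O] and so in [B], although it avoids
   [N]. *)
have [v [_ _ [u [c Bc cu] uv] pv]] := Pp r r0.
apply: NNp; exists p; last by rewrite distxx.
rewrite BO; split=> //; apply: (rO c) => //.
have := dist_tri u c p; have := dist_tri v u p; rewrite (dist_sym v p); lra.
Qed.

(** For the inclusion into the chain component: in a connected [C], the points joined to [x] by
    [e]-chains form a clopen subset, because no distance below [e] separates a joined point from one
    that is not joined. *)
Lemma connected_componentE A x : compact A -> A x ->
  connected_component A x = chain_component A x.
Proof.
move=> cA Ax; apply/seteqP; split; last first.
  apply: connected_component_max; last exact: connected_chain_component.
    by move=> e _; exact: chain_refl.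
  by move=> y /(_ 1 ltr01); exact: chain_in.
move=> y [C [Cx CA cC] Cy] e e0.
suff : C `&` [set z | chain A e x z] = C.
  by move=> /seteqP[_ /(_ _ Cy)[]].
apply: cC; first by exists x; split=> //; exact: chain_refl.
  exists [set z | exists2 u, [set u | C u /\ chain A e x u] u & dist u z < e].
    exact: open_thickening.
  apply/seteqP; split=> z [Cz].
    by move=> xz; split=> //; exists z; [split|rewrite distxx].
  by move=> [u [Cu xu] uz]; split=> //; apply: chain_step xu (CA _ Cz) uz.
exists (~` [set z | exists2 u, [set u | C u /\ ~ chain A e x u] u & dist u z < e]).
  by apply: open_closedC; exact: open_thickening.
apply/seteqP; split=> z [Cz].
  move=> xz; split=> // -[u [Cu xu] uz]; apply: xu.
  by apply: chain_step xz (CA _ Cu) _; rewrite dist_sym.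
move=> xz; split=> //; apply: contrapT => Nxz; apply: xz.
by exists z => //; rewrite distxx.
Qed.

End ChainComponents.

(** * Compact subgroups *)

Section CompactSubgroupTheory.
Variables (R : realType) (d : forall n, biinvariant_metric R n.+1).
Implicit Types (G H K : compact_subgroup d) (x y z g : SUprod R).
Local Notation dist := (SUdist d).

Lemma csg1 G : csg_set G 1%g.
Proof. by apply: set_mem; case: (csg_group G). Qed.

Lemma csgV G g : csg_set G g -> csg_set G g^-1%g.
Proof.
by move=> /mem_set Gg; apply/set_mem/(group_closedV (csg_group G)).
Qed.

Lemma csgM G x y : csg_set G x -> csg_set G y -> csg_set G (x * y)%g.
Proof.
by move=> /mem_set Gx /mem_set Gy; apply/set_mem/(group_closedM (csg_group G)).
Qed.

Lemma csg_chainM G e g x y : csg_set G g ->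
  chain dist G e x y -> chain dist G e (g * x)%g (g * y)%g.
Proof.
move=> Gg; apply: (chain_map (f := fun x => (g * x)%g)); first exact: SUdistMl.
by move=> u; exact: csgM.
Qed.

Lemma identity_componentE G :
  identity_component G = chain_component dist G 1%g.
Proof.
apply: connected_componentE (@csg_compact _ _ G) (csg1 G).
- exact: SUdistxx.
- exact: SUdist_sym.
- exact: SUdist_triangle.
- exact: SUdist_nbhs.
Qed.

Lemma coset_relP G (x y : set_type G) :
  coset_rel x y <-> chain_component dist G (\val x) (\val y).
Proof.
have Gv (u : set_type G) : csg_set G (\val u) by exact/set_mem/valP.
have sub (u v : set_type G) : chain_component dist G (\val u) (\val v) ->
    [set (\val u * g)%g | g in identity_component G] `<=`
    [set (\val v * g)%g | g in identity_component G].
  rewrite identity_componentE => uv _ [g g1 <-].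
  (* After translation by [v], this element is joined to 1 as soon as [v] is joined to [u * g]; the
     chain passes through [u]. *)
  exists ((\val v)^-1 * (\val u * g))%g; last by rewrite mulVKg.
  move=> e e0; rewrite -(mulVg (\val v)); apply: csg_chainM (csgV (Gv v)) _.
  have vu : chain dist G e (\val v) (\val u).
    by apply: chain_sym (uv e e0) => //; exact: SUdist_sym.
  apply: chain_trans vu _.
  by rewrite -{1}(mulg1 (\val u)); apply: csg_chainM (Gv u) (g1 e e0).
split=> [/asboolP xy e e0|xy].
  have : [set (\val x * g)%g | g in identity_component G] (\val y).
    rewrite xy; exists 1%g; last exact: mulg1.
    by rewrite identity_componentE => e' _; exact: chain_refl.
  move=> [g]; rewrite identity_componentE => /(_ e e0) g1 <-.
  by rewrite -{1}(mulg1 (\val x)); exact: csg_chainM.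
apply/asboolP; apply/seteqP; split; first exact: (sub x y).
apply: (sub y x) => e e0.
by apply: chain_sym (xy e e0) => //; exact: SUdist_sym.
Qed.

Lemma csg_dist_lt G H e x : csg_dist G H < e -> csg_set G x ->
  exists2 y, csg_set H y & dist x y < e.
Proof.
move=> GH Gx; have : dist_to_set dist x H < e.
  apply: le_lt_trans GH; apply: hausdorff_dist_ge (csg_neq0 H) Gx.
  - exact: SUdist_ge0.
  - exact: SUdist_le1.
move=> /inf_lt[|_ [y Hy <-] xy]; last by exists y.
by exists (dist x 1%g), 1%g => //; exact: csg1.
Qed.

Lemma csg_dist_le G H e :
  (forall x, csg_set G x -> exists2 y, csg_set H y & dist x y <= e) ->
  (forall y, csg_set H y -> exists2 x, csg_set G x & dist y x <= e) ->
  csg_dist G H <= e.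
Proof.
have sub (A B : compact_subgroup d) :
    (forall x, csg_set A x -> exists2 y, csg_set B y & dist x y <= e) ->
    sup [set dist_to_set dist x B | x in csg_set A] <= e.
  move=> AB; apply: ge_sup.
    by exists (dist_to_set dist 1%g B), 1%g => //; exact: csg1.
  move=> _ [x /AB[y By xy] <-]; apply: le_trans xy; apply: ge_inf; last by exists y.
  by exists 0 => _ [z _ <-]; exact: SUdist_ge0.
by move=> GH HG; rewrite /csg_dist /hausdorff_dist ge_max !sub.
Qed.

End CompactSubgroupTheory.

(** * A diagonal involution in each special unitary group *)

Section Involution.
Local Open Scope sesquilinear_scope.
Variables (R : realType) (n : nat).

(** Two entries [-1] keep the determinant equal to 1. Size 1 leaves only the identity, as SU(1) is
    trivial. *)
Definition involution_mx : 'M[R[i]]_n.+1 :=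
  diag_mx (\row_j (if (0 < n)%N && (j < 2)%N then -1 else 1)).

Lemma involution_mxK : involution_mx *m involution_mx = 1%:M.
Proof.
rewrite /involution_mx mulmx_diag -diag_const_mx; congr diag_mx.
by apply/rowP => j; rewrite !mxE; case: ifP; rewrite ?mulr1 ?mulrNN ?mulr1.
Qed.

Lemma involution_special_unitary : involution_mx \in @special_unitary R n.+1.
Proof.
rewrite inE; apply/andP; split.
  apply/unitarymxP; rewrite -[RHS]involution_mxK; congr (_ *m _).
  rewrite /involution_mx tr_diag_mx map_diag_mx; congr diag_mx.
  by apply/rowP => j; rewrite !mxE; case: ifP; rewrite ?rmorphN rmorph1.
rewrite /involution_mx det_diag; case: n => [|m].
  by rewrite big_ord_recl big_ord0 !mxE mulr1.
rewrite 2!big_ord_recl !mxE big1 ?mulr1 ?mulrNN ?mulr1// => j _.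
by rewrite mxE.
Qed.

Definition involution := MkSU involution_special_unitary.

Lemma involutionV : (involution^-1)%g = involution.
Proof.
by apply: (@mulgI _ involution); rewrite mulgV; exact/esym/val_inj/involution_mxK.
Qed.

Lemma involution_neq1 : (0 < n)%N -> involution <> 1%g.
Proof.
move=> n0 /(congr1 (fun x : SU R n.+1 => SUval x ord0 ord0)).
rewrite /= !mxE/= n0/= => /eqP; rewrite -subr_eq0 -opprD oppr_eq0.
by rewrite -mulr2n pnatr_eq0.
Qed.

End Involution.

(** * Truncated subgroups *)

Section Truncation.
Variables (R : realType) (d : forall n, biinvariant_metric R n.+1).
Implicit Types (G H K : compact_subgroup d) (x y z g : SUprod R).
Local Notation dist := (SUdist d).

Definition truncate i (b : bool) g : SUprod R := fun j =>
  if (j < i)%N then g j else if (j == i) && b then involution R j else 1%g.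

Lemma truncate_lt i b g j : (j < i)%N -> truncate i b g j = g j.
Proof. by rewrite /truncate => ->. Qed.

Lemma truncate_eq i b g : truncate i b g i = if b then involution R i else 1%g.
Proof. by rewrite /truncate ltnn eqxx. Qed.

Lemma truncate1 i : truncate i false 1%g = 1%g.
Proof.
by apply: functional_extensionality_dep => j; rewrite /truncate andbF if_same.
Qed.

(** Booleans under [(+)] model the two-element group generated by the involution, so truncation is a
    homomorphism in the pair of boolean and group element. *)
Lemma truncate_div i a b x y :
  (truncate i a x / truncate i b y)%g = truncate i (a (+) b) (x / y)%g.
Proof.
apply: functional_extensionality_dep => j; rewrite /truncate.
transitivity (truncate i a x j / truncate i b y j)%g; first by [].
rewrite /truncate; case: ifP => [//|_]; case: eqVneq => _ /=.
  by case: a; case: b => /=; rewrite ?mulgV ?invg1 ?mulg1 ?mul1g ?involutionV.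
by rewrite mulgV.
Qed.

Lemma truncate_continuous i b : continuous (truncate i b).
Proof.
move=> g; have Fg : Filter (nbhs g) := @nbhs_filter (SUprod R) g.
apply/cvg_sup => j U [_ [[V oV <-] Vx] VU].
suff : \forall y \near g, V (truncate i b y j) by apply: filterS => y /VU.
move: Vx; rewrite /= /truncate; case: ifP => _ Vx; last by apply: filterE.
by apply: (@cvg_proj R j g); exact: open_nbhs_nbhs.
Qed.

Definition truncated_set G i : set (SUprod R) :=
  \bigcup_(b in [set: bool]) (truncate i b @` csg_set G).

Lemma truncated_compact G i : compact (truncated_set G i).
Proof.
have cb b : compact (truncate i b @` csg_set G).
  apply: continuous_compact (@csg_compact _ _ G).
  by apply: continuous_subspaceT; exact: truncate_continuous.
rewrite (_ : truncated_set G i =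
    truncate i false @` csg_set G `|` truncate i true @` csg_set G).
  exact: compactU.
apply/seteqP; split=> x; first by move=> [[] _]; [right|left].
by case; [exists false|exists true].
Qed.

Lemma truncated_group G i : group_closed (mem (truncated_set G i)).
Proof.
split.
  apply/mem_set; exists false => //; exists 1%g; last exact: truncate1.
  exact: csg1.
move=> _ _ /set_mem[a _ [x Gx <-]] /set_mem[b _ [y Gy <-]].
apply/mem_set; exists (a (+) b) => //; exists (x / y)%g; last by rewrite truncate_div.
by apply: csgM => //; exact: csgV.
Qed.

Definition truncated G i : compact_subgroup d :=
  @CompactSubgroup R d _ (@truncated_compact G i) (@truncated_group G i).

Lemma SUdist_truncate i b g : dist g (truncate i b g) <= 2 ^- i.
Proof.
rewrite -[leRHS]add0r; apply: SUdist_le => // j ji.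
by rewrite truncate_lt// bidistxx.
Qed.

Lemma csg_dist_truncated G i : csg_dist G (truncated G i) <= 2 ^- i.
Proof.
apply: csg_dist_le => [x Gx|_ [b _ [x Gx <-]]].
  by exists (truncate i false x); [exists false => //; exists x|exact: SUdist_truncate].
by exists x => //; rewrite SUdist_sym; exact: SUdist_truncate.
Qed.

(** The [i]-th coordinates of [K] lie within [c / 3] of 1 or of the involution, which are at
    distance [c]. A chain of mesh [2^-(i+1) * (c / 3)] moves this coordinate by less than [c / 3]
    per step and cannot jump from one cluster to the other. *)
Lemma truncated_component G K i c : c = d i 1%g (involution R i) ->
  csg_dist (truncated G i) K < 2 ^- i.+1 * (c / 3) ->
  identity_component K `<=` [set x | d i 1%g (x i) < c / 3].
Proof.
move=> cE GK x; rewrite identity_componentE => Kx.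
have K2 y : csg_set K y ->
    d i 1%g (y i) < c / 3 \/ d i (involution R i) (y i) < c / 3.
  move=> Ky; rewrite csg_dist_sym in GK.
  have [_ [b _ [g _ <-]] yg] := csg_dist_lt GK Ky.
  have := bidist_lt_SUdist yg; rewrite truncate_eq bidist_sym.
  by case: b yg => _ ?; [right|left].
(* The mesh is positive because it exceeds a Hausdorff distance. *)
have : 0 < 2 ^- i.+1 * (c / 3).
  apply: le_lt_trans GK; apply: hausdorff_dist_ge0 (csg_neq0 _) (csg_neq0 _).
    exact: SUdist_ge0.
  exact: SUdist_le1.
move=> e0; have := Kx _ e0.
rewrite pmulr_rgt0 ?invr_gt0 ?exprn_gt0// in e0.
elim=> [|y z _ y1 Kz yz] /=; first by rewrite bidistxx.
(* In the other case the path from 1 via [y] and [z] to the involution has length below three times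
   [c / 3]. *)
have [//|zi] := K2 _ Kz.
have := bidist_lt_SUdist yz.
have := bidist_triangle (d i) (y i) 1%g (z i).
have := bidist_triangle (d i) (z i) 1%g (involution R i).
rewrite -cE (bidist_sym _ (z i)); move: y1 => /=; lra.
Qed.

Lemma nowhere_dense_open_component e : 0 < e ->
  nowhere_dense [set G : compact_subgroup d |
    forall x, csg_set G x -> dist 1%g x < e -> identity_component G x].
Proof.
move=> e0; apply/seteqP; split=> // G /nbhs_ballP[r r0 rF].
(* [0 < i] makes the involution nontrivial, [2^-i < r] puts the truncated group into the ball about
   [G], and [2^-i < e / 2] puts the element [truncate i true 1] near 1. *)
have [i [i0 ir ie]] : exists i, [/\ (0 < i)%N, 2 ^- i < r & 2 ^- i < e / 2].
  have e20 : 0 < e / 2 by rewrite divr_gt0.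
  have [i [i0 [ir ie]]] := filter_ex (filterI (nbhs_infty_gt 0)
    (filterI (near_exp2V r0) (near_exp2V e20))).
  by exists i.
pose c := d i 1%g (involution R i).
have c0 : 0 < c.
  rewrite lt_neqAle bidist_ge0 andbT; apply/eqP => /esym/bidist_eq0/esym.
  exact: involution_neq1.
(* The first bound controls the [i]-th coordinates of [K]; the second keeps the point [x] of [K]
   near [truncate i true 1] inside the [e]-ball about 1. *)
pose t := Num.min (2 ^- i.+1 * (c / 3)) (e / 2).
have t0 : 0 < t by rewrite lt_min !mulr_gt0 ?invr_gt0 ?exprn_gt0 ?divr_gt0.
have HF : closure [set G : compact_subgroup d |
    forall x, csg_set G x -> dist 1%g x < e -> identity_component G x]
    (truncated G i).
  by apply: rF; rewrite ballEmdist/=; exact: le_lt_trans (csg_dist_truncated G i) ir.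
have [|K [KF]] := HF (ball (truncated G i) t); first exact: nbhsx_ballx.
rewrite ballEmdist/= => HK.
have Hh : csg_set (truncated G i) (truncate i true 1%g).
  by exists true => //; exists 1%g => //; exact: csg1.
have [x Kx hx] := csg_dist_lt HK Hh.
have := HK; rewrite lt_min => /andP[/(truncated_component erefl) + _].
move=> /(_ x) /=; have : identity_component K x.
  apply: KF => //; have := SUdist_truncate i true 1%g.
  have := SUdist_triangle d (truncate i true 1%g) 1%g x.
  by move: hx; rewrite lt_min => /andP[_]; lra.
move=> /[swap]/[apply].
move: hx; rewrite lt_min => /andP[/bidist_lt_SUdist + _].
rewrite truncate_eq -/c.
have := bidist_triangle (d i) (x i) 1%g (involution R i).
rewrite -/c (bidist_sym _ (x i)); lra.
Qed.

End Truncation.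

(** * The component group as an ultrametric space *)

Lemma compact_set_type (T : topologicalType) (A : set T) :
  compact A -> compact [set: set_type A].
Proof.
move=> cA F FF _; pose v (x : set_type A) : T := \val x.
have vA : F (v @^-1` A) by apply: filterS filterT => x _; exact: set_valP.
have [p [Ap clp]] := cA (v @ F) _ vA.
exists (exist _ p (mem_set Ap)); split=> // B N FB [_ [[V oV <-] Vp] VN].
have [|_ [[x Bx <-] Vx]] := clp (v @` B) V _ (open_nbhs_nbhs (conj oV Vp)).
  by rewrite /fmap/=; apply: filterS FB => x Bx; exists x.
by exists x; split=> //; exact: VN.
Qed.

(** Preimages of closed sets under [g] are images of compact sets under [f], hence closed. *)
Lemma compact_hausdorff_cancel_continuous (T U : topologicalType)
    (f : T -> U) (g : U -> T) : compact [set: T] -> hausdorff_space U ->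
  continuous f -> cancel f g -> cancel g f -> continuous g.
Proof.
move=> cT hU cf fK gK; apply/continuous_closedP => A cA.
rewrite (_ : g @^-1` A = f @` A).
  apply: compact_closed hU _; apply: continuous_compact.
    exact: continuous_subspaceT.
  exact: subclosed_compact cA cT _.
apply/seteqP; split=> [y Ay|_ [x Ax <-]]; first by exists (g y).
by rewrite /= fK.
Qed.

Section ChainSpace.
Local Open Scope quotient_scope.
Variables (R : realType) (d : forall n, biinvariant_metric R n.+1).
Variable G : compact_subgroup d.
Local Notation dist := (SUdist d).

(** An alias of the quotient, so that the chain balls can define a second topology on the same
    points. *)
Definition chain_space : Type := component_group G.
Implicit Types p q r : chain_space.

HB.instance Definition _ := Choice.copy chain_space (component_group G).

Let G1 : set_type (csg_set G) := exist _ 1%g (mem_set (csg1 G)).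

HB.instance Definition _ :=
  isPointed.Build chain_space (\pi_(component_group G) G1).

Definition chain_repr p : SUprod R := \val (repr (p : component_group G)).

(* Without 0 < e the triangle inequality would fail for radii of opposite signs. *)
Definition chain_ball p e : set chain_space :=
  [set q | 0 < e /\ chain dist G e (chain_repr p) (chain_repr q)].

Let chain_repr_in p : csg_set G (chain_repr p).
Proof. exact/set_mem/valP. Qed.

Let chain_ball_center p e : 0 < e -> chain_ball p e p.
Proof. by move=> e0; split=> //; exact: chain_refl. Qed.

Let chain_ball_sym p q e : chain_ball p e q -> chain_ball q e p.
Proof. by move=> [e0 pq]; split=> //; apply: chain_sym pq => //; exact: SUdist_sym. Qed.

(** The ultrametric inequality: concatenating chains does not enlarge the mesh. It makes balls
    clopen. *)
Lemma chain_ball_trans p q r e :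
  chain_ball p e q -> chain_ball q e r -> chain_ball p e r.
Proof. by move=> [e0 pq] [_ qr]; split=> //; exact: chain_trans qr. Qed.

Let chain_ball_triangle p q r e1 e2 :
  chain_ball p e1 q -> chain_ball q e2 r -> chain_ball p (e1 + e2) r.
Proof.
move=> [e1_gt0 pq] [e2_gt0 qr]; split; first exact: addr_gt0.
by apply: chain_trans (chain_le _ pq) (chain_le _ qr); rewrite ?lerDl ?lerDr ltW.
Qed.

Let ent : set_system (chain_space * chain_space) := entourage_ chain_ball.

HB.instance Definition _ := hasNbhs.Build chain_space (nbhs_ ent).

HB.instance Definition _ := @Nbhs_isPseudoMetric.Build R chain_space
  ent erefl chain_ball chain_ball_center chain_ball_sym chain_ball_triangle erefl.

Lemma chain_repr_pi (x : set_type (csg_set G)) :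
  chain_component dist G (chain_repr (\pi_(component_group G) x)) (\val x).
Proof.
apply/coset_relP/(@eqmodP _ (coset_equiv (csg_set G))).
exact: (reprK (\pi_(component_group G) x)).
Qed.

Lemma chain_space_eq p q : (forall e, 0 < e -> ball p e q) -> p = q.
Proof.
move=> pq; rewrite -[p](@reprK _ (component_group G)) -[q](@reprK _ (component_group G)).
apply/eqmodP/coset_relP => e e0.
by have [] := pq e e0.
Qed.

Lemma chain_space_hausdorff : hausdorff_space chain_space.
Proof.
move=> p q clpq; apply: chain_space_eq => e e0.
have [r [pr qr]] := clpq _ _ (nbhsx_ballx p e e0) (nbhsx_ballx q e e0).
exact: chain_ball_trans pr (chain_ball_sym qr).
Qed.

Lemma chain_space_zero_dimensional : zero_dimensional chain_space.
Proof.
move=> p q /eqP pq.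
have /existsNP[e /not_implyP[e0 Npq]] : ~ forall e, 0 < e -> ball p e q.
  by move=> /chain_space_eq.
exists (ball p e); split=> //; last exact: ballxx.
split.
  rewrite openE => r pr; apply/nbhs_ballP; exists e => // s rs.
  exact: chain_ball_trans pr rs.
move=> r clr; have [s [ps rs]] := clr _ (nbhsx_ballx r e e0).
exact: chain_ball_trans ps (chain_ball_sym rs).
Qed.

Definition to_chain_space (p : component_group G) : chain_space := p.

(** Points of [G] at distance less than [e] form a one-step chain, and each is joined to the chosen
    representative of its coset by chains of any mesh. *)
Lemma to_chain_space_continuous : continuous to_chain_space.
Proof.
apply/quotient_continuous => x U /nbhs_ballP[e e0 eU].
have : nbhs x [set y : set_type (csg_set G) | dist (\val x) (\val y) < e].
  have nx : nbhs (\val x : SUprod R) [set y | dist (\val x) y < e].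
    by apply/(SUdist_nbhs d); exists e.
  exact: (@initial_continuous (set_type (csg_set G)) (SUprod R) set_val x _ nx).
apply: filterS => y xy; apply: eU; split=> //.
apply: chain_trans (chain_repr_pi x e0) _.
have yy : chain dist G e (\val y) (chain_repr (\pi_(component_group G) y)).
  apply: chain_sym (chain_repr_pi y e0) => //; exact: SUdist_sym.
apply: chain_trans yy; apply: chain_step (chain_refl _ _ _ _) _ xy.
exact/set_mem/valP.
Qed.

Lemma component_group_compact : compact [set: component_group G].
Proof.
rewrite (_ : setT = \pi_(component_group G) @` setT).
  apply: continuous_compact; first exact/continuous_subspaceT/pi_continuous.
  exact/compact_set_type/csg_compact.
by apply/seteqP; split=> // p _; exists (repr p) => //; exact: reprK.
Qed.

Lemma chain_space_compact : compact [set: chain_space].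
Proof.
rewrite (_ : setT = to_chain_space @` setT).
  apply: continuous_compact component_group_compact.
  exact/continuous_subspaceT/to_chain_space_continuous.
by apply/seteqP; split=> // p _; exists p.
Qed.

Lemma chain_space_perfect :
  (forall e, 0 < e -> exists x, [/\ csg_set G x, dist 1%g x < e &
    ~ identity_component G x]) ->
  perfect_set [set: chain_space].
Proof.
move=> Gx; split; first exact: closedT.
apply/seteqP; split=> // p _ U /nbhs_ballP[e e0 eU].
have [x [Gxx x1 Nx]] := Gx e e0.
have Gpx : csg_set G (chain_repr p * x)%g by exact: csgM.
(* Translating the given [x] by the representative of [p] yields a coset near [p]; if it were [p]
   itself, translating back would put [x] in the identity component. *)
pose px : set_type (csg_set G) := SigSub (mem_set Gpx).
pose q : chain_space := \pi_(component_group G) px.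
have cpx : chain_component dist G (chain_repr q) (chain_repr p * x)%g.
  exact: chain_repr_pi px.
exists q; split=> //; last first.
  apply: eU; split=> //.
  have qq : chain dist G e (chain_repr p * x)%g (chain_repr q).
    by apply: chain_sym (cpx e e0) => //; exact: SUdist_sym.
  apply: chain_trans qq; apply: (chain_step (chain_refl _ _ _ _) Gpx).
  by rewrite -{1}(mulg1 (chain_repr p)) SUdistMl.
apply/eqP => qp; apply: Nx; rewrite identity_componentE => r r0.
rewrite -(mulVg (chain_repr p)) -[x](mulKg (chain_repr p)).
by apply: csg_chainM; [exact: csgV|rewrite -{1}qp; exact: cpx].
Qed.

Lemma component_group_homeomorphic_cantor :
  (forall e, 0 < e -> exists x, [/\ csg_set G x, dist 1%g x < e &
    ~ identity_component G x]) ->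
  homeomorphic (component_group G) cantor_space.
Proof.
move=> Gx; have cl : cantor_like chain_space.
  split; first exact: chain_space_perfect.
  - exact: chain_space_compact.
  - exact: chain_space_hausdorff.
  - exact: chain_space_zero_dimensional.
have [f [cf _]] := homeomorphism_cantor_like cl.
have fK : cancel f f^-1 by move=> x; apply: funK; rewrite inE.
have gK : cancel f^-1 f by move=> y; apply: invK; rewrite inE.
have cg : continuous f^-1 := compact_hausdorff_cancel_continuous
  cantor_space_compact chain_space_hausdorff cf fK gK.
exists (f^-1 \o to_chain_space), (fun x => f x : component_group G); split.
- by move=> p /=; rewrite gK.
- by move=> x /=; rewrite /to_chain_space fK.
- by move=> p; apply: continuous_comp; [exact: to_chain_space_continuous|exact: cg].
(* The quotient is compact and the chain topology Hausdorff, so the two topologies agree and [f]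
   remains continuous into the quotient. *)
- have ci : continuous (fun p : chain_space => p : component_group G).
    exact: (@compact_hausdorff_cancel_continuous _ _ to_chain_space _
      component_group_compact chain_space_hausdorff to_chain_space_continuous
      (fun=> erefl) (fun=> erefl)).
  move=> x.
  exact: (@continuous_comp _ _ _ f (fun p => p : component_group G) x
    (cf x) (ci _)).
Qed.

End ChainSpace.

Theorem theorem5p17 (R : realType)
    (d : forall n : nat, biinvariant_metric R n.+1) :
  comeager [set G : compact_subgroup d |
    homeomorphic (component_group G) cantor_space].
Proof.
(* The radii [1 / (k + 1)] are cofinal: a group outside all these sets has points arbitrarily near 1
   that are not in its identity component. *)
exists (fun k => [set G : compact_subgroup d | forall x, csg_set G x ->
  SUdist d 1%g x < k.+1%:R^-1 -> identity_component G x]).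
  by move=> k; apply: nowhere_dense_open_component; rewrite invr_gt0 ltr0n.
move=> G; apply: contra_notP => NG; apply: component_group_homeomorphic_cantor => e e0.
have [k _ /(_ k (leqnn _)) ke] := near_infty_natSinv_lt (PosNum e0).
apply: contrapT => /forallNP Gx; apply: NG; exists k => // x Gxx x1.
by apply: contrapT => Nx; apply: (Gx x); split=> //; exact: lt_trans ke.
Qed.
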